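(* In the setting below, fix a node $i\in\{1,\dots,m\}$ and $0<\epsilon<1$. Repeat $h$ times independently: prepare $|0_{G_i}\rangle|0_G\rangle$, apply $\mathrm{QFT}_{G_i}\otimes\mathrm{I}_G$, then $U_{f_i}$, then $\mathrm{QFT}_{G_i}^\dagger\otimes\mathrm{I}_G$, and measure the first register obtaining $\mathbf{m}_j\in G_i$. Let $M_h=\{\mathbf{m}_1,\dots,\mathbf{m}_h\}$ and $A_i=\{x\in G_i:\langle \mathbf{m}_j,x\rangle_i=0\ \forall j\}=(\mathrm{span}(M_h))^\perp$. Then $\Pr(A_i=K_i)\ge 1-\epsilon/m$ provided \[h\ge\mathrm{rank}(G_i)+\left\lceil\log_2\tfrac{2m}{\epsilon}\right\rceil\quad\text{or}\quad h\ge\mathrm{len}(G_i)-\mathrm{len}(K_i)+\left\lceil\log_2\tfrac{m}{\epsilon}\right\rceil.\]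
   Context: Setting: $p_1,\dots,p_m$ distinct primes, $G=G_1\oplus\cdots\oplus G_m$, $G_i=\bigoplus_{j=1}^{r_i}\mathbb{Z}_{p_i^{\alpha_{ij}}}$ ($\alpha_{ij}\ge1$); $f:G\to G$ with $f(x)=f(y)\iff x-y\in K$, $K\le G$; $K=K_1\oplus\cdots\oplus K_m$ with $K_i\le G_i$; $f_i(g_i)=f(0_1,\dots,g_i,\dots,0_m)$. $\langle x,y\rangle_i=\sum_j x_{ij}y_{ij}/p_i^{\alpha_{ij}}\pmod1$ on $G_i$; $H^\perp=\{g\in G_i:\langle h,g\rangle_i=0\ \forall h\in H\}$ for $H\le G_i$; $\mathrm{span}$ = generated subgroup. $\mathrm{rank}$ = minimal number of generators; $\mathrm{len}$ = composition length (for $|H|=p^e$, $\mathrm{len}(H)=e$). $\mathcal{H}_{G_i}$, $\mathcal{H}_G$ have computational bases indexed by $G_i$, $G$; $\mathrm{QFT}_{G_i}=\bigotimes_j\mathrm{QFT}_{p_i^{\alpha_{ij}}}$ with $\mathrm{QFT}_N|x\rangle=\frac1{\sqrt N}\sum_y e^{2\pi ixy/N}|y\rangle$; $U_{f_i}|g\rangle|b\rangle=|g\rangle|b+f_i(g)\rangle$. *)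

(* Defs.v *)
From HB Require Import structures.
From mathcomp Require Import all_boot all_order all_algebra.
From mathcomp Require Import reals trigo exp.
From mathcomp Require Import complex.
Set Implicit Arguments. Unset Strict Implicit. Unset Printing Implicit Defensive.
Import Order.TTheory GRing.Theory Num.Theory.
Local Open Scope ring_scope.

(* (p_i prime and alpha_ij >= 1 give p_i^alpha_ij >= 2, so 'Z_ is exact.) *)

Definition Gi (m : nat) (p r : 'I_m -> nat) (al : forall i, 'I_(r i) -> nat)
  (i : 'I_m) : finType :=
  {dffun forall j : 'I_(r i), 'Z_(p i ^ al i j)}.

Definition Gall (m : nat) (p r : 'I_m -> nat) (al : forall i, 'I_(r i) -> nat)
  : finType := {dffun forall i : 'I_m, Gi p al i}.

Section Ops.
Variables (m : nat) (p r : 'I_m -> nat) (al : forall i, 'I_(r i) -> nat).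

Definition zeroGi (i : 'I_m) : Gi p al i := [ffun j => 0].
Definition addGi (i : 'I_m) (x y : Gi p al i) : Gi p al i := [ffun j => x j + y j].
Definition subGi (i : 'I_m) (x y : Gi p al i) : Gi p al i := [ffun j => x j - y j].

Definition zeroG : Gall p al := [ffun i => zeroGi i].
Definition addG (x y : Gall p al) : Gall p al := [ffun i => addGi (x i) (y i)].
Definition subG (x y : Gall p al) : Gall p al := [ffun i => subGi (x i) (y i)].

Definition embedG (i : 'I_m) (g : Gi p al i) : Gall p al :=
  finfun (dfwith (fun k => zeroGi k) g).

Definition subgroupGi (i : 'I_m) (H : {set Gi p al i}) : bool :=
  (zeroGi i \in H) && [forall x in H, forall y in H, subGi x y \in H].
Definition subgroupG (H : {set Gall p al}) : bool :=
  (zeroG \in H) && [forall x in H, forall y in H, subG x y \in H].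

Definition spanGi (i : 'I_m) (S : {set Gi p al i}) : {set Gi p al i} :=
  \bigcap_(H : {set Gi p al i} | subgroupGi H && (S \subset H)) H.

Definition rankGi (i : 'I_m) (H : {set Gi p al i}) : nat :=
  #| [arg min_(S < H | spanGi S == H) #|S| ] |.

(* composition length of a finite abelian group H: the number of prime
   factors of |H| counted with multiplicity (for |H| = p^e it is e) *)
Definition lenGi (i : 'I_m) (H : {set Gi p al i}) : nat :=
  \sum_(q <- primes #|H|) logn q #|H|.

End Ops.

Section Quantum.
Variable R : realType.
Local Open Scope complex_scope.
Variables (m : nat) (p r : 'I_m -> nat) (al : forall i, 'I_(r i) -> nat).

(* <x,y>_i = sum_j x_ij y_ij / p_i^alpha_ij  (mod 1) is 0 *)
Definition pairing0 (i : 'I_m) (x y : Gi p al i) : bool :=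
  (\sum_(j < r i) ((nat_of_ord (x j) * nat_of_ord (y j))%:R / (p i ^ @al i j)%N%:R : R))
    \is a Num.int.

Definition expi2pi (t : R) : R[i] := (cos (2 * pi * t)) +i* (sin (2 * pi * t)).

(* matrix entry <y| QFT_{G_i} |x> = prod_j (1/sqrt N_j) e^{2 pi i x_j y_j / N_j},
   QFT_{G_i} = tensor product over j of QFT_{p_i^alpha_ij} *)
Definition qftGi (i : 'I_m) (y x : Gi p al i) : R[i] :=
  \prod_(j < r i)
     ((Num.sqrt ((p i ^ @al i j)%N%:R : R))^-1 %:C *
      expi2pi ((nat_of_ord (x j) * nat_of_ord (y j))%:R / (p i ^ @al i j)%N%:R)).

(* states of H_{G_i} (x) H_G are functions G_i * G -> C *)
Definition init_state (i : 'I_m) (x : Gi p al i) (b : Gall p al) : R[i] :=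
  if (x == zeroGi p al i) && (b == zeroG p al) then 1 else 0.

Definition apply_qft (i : 'I_m) (psi : Gi p al i -> Gall p al -> R[i])
  (y : Gi p al i) (b : Gall p al) : R[i] :=
  \sum_(x : Gi p al i) qftGi y x * psi x b.

Definition apply_qft_dag (i : 'I_m) (psi : Gi p al i -> Gall p al -> R[i])
  (x : Gi p al i) (b : Gall p al) : R[i] :=
  \sum_(y : Gi p al i) (qftGi y x)^* * psi y b.

(* U_{f_i} |g>|b> = |g>|b + f_i(g)>, i.e. (U psi)(g, b) = psi(g, b - f_i(g)) *)
Definition apply_U (i : 'I_m) (fi : Gi p al i -> Gall p al)
  (psi : Gi p al i -> Gall p al -> R[i]) (g : Gi p al i) (b : Gall p al) : R[i] :=
  psi g (subG b (fi g)).

Definition final_state (i : 'I_m) (fi : Gi p al i -> Gall p al) :=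
  apply_qft_dag (apply_U fi (apply_qft (@init_state i))).

Definition sqnorm (z : R[i]) : R := (complex.Re z) ^+ 2 + (complex.Im z) ^+ 2.

Definition meas_prob (i : 'I_m) (fi : Gi p al i -> Gall p al) (x : Gi p al i) : R :=
  \sum_(b : Gall p al) sqnorm (final_state fi x b).

Definition A_of (i : 'I_m) (h : nat) (ms : {ffun 'I_h -> Gi p al i})
  : {set Gi p al i} :=
  [set x | [forall k, pairing0 (ms k) x]].

Definition prob_A_eq (i : 'I_m) (fi : Gi p al i -> Gall p al) (h : nat)
  (Ki : {set Gi p al i}) : R :=
  \sum_(ms : {ffun 'I_h -> Gi p al i} | A_of ms == Ki) \prod_(k < h) meas_prob fi (ms k).

End Quantum.

(* Main.v *)
Require Import Defs.
From HB Require Import structures.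
From mathcomp Require Import all_boot all_order all_algebra.
From mathcomp Require Import all_fingroup all_solvable.
From mathcomp Require Import reals trigo exp.
From mathcomp Require Import complex.
Import Order.TTheory GRing.Theory Num.Theory.
Local Open Scope ring_scope.

(* Write H for K_i, V for G_i and chi_m(x) = e^{2 pi i <m,x>}. The measured
   distribution is P(m) = |V|^-1 sum_{k in H} chi_m(k), supported on H^perp.
   If the kernel A of the samples is not H, then A/H is a nontrivial p-group,
   so A contains a whole coset x + H with x not in H and p x in H. For such x
   the event chi_m(x) = 1 has probability 1/p, hence Markov's inequality for
   the number of those x in A bounds the failure probability by
   |S| / (|H| p^h) with S = {x | p x in H}. Finally |S| <= |V|, and
   |S| <= |H| |V[p]| = |H| p^rank(V) since x |-> p x maps S to H with fibres
   contained in cosets of V[p]. *)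

(** * Sampling from the annihilator of a subgroup *)

(** Subtracting one chosen point from a fibre of [x |-> x *+ n] embeds that fibre in the
    [n]-torsion. *)
Lemma card_mulrn_preim {V : finZmodType} (n : nat) (K : {set V}) :
  (#|[set x | (x *+ n)%R \in K]| <= #|K| * #|[set x : V | (x *+ n == 0)%R]|)%N.
Proof.
rewrite -sum1_card (partition_big (fun x => x *+ n) (mem K)) /=; last first.
  by move=> x; rewrite inE.
rewrite -sum_nat_const leq_sum // => k _; rewrite sum1_card.
case: (pickP (fun x : V => x *+ n == k)) => [x0 /eqP x0k|none]; last first.
  by rewrite eq_card0 // => x; rewrite unfold_in /= none andbF.
rewrite -(card_imset _ (addIr (- x0))); apply/subset_leq_card/subsetP => y.
case/imsetP => x; rewrite unfold_in /= => /andP[_ /eqP xk] ->.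
by rewrite inE mulrnBl xk x0k subrr.
Qed.

(** The [p]-torsion lies in the first Ohm subgroup, whose order is [p] to the rank, and the rank of
    an abelian [p]-group is its minimal number of generators. *)
Lemma card_torsion_le {V : finZmodType} (p : nat) :
  (p.-group [set: V])%g ->
  (#|[set x : V | (x *+ p == 0)%R]| <= p ^ 'm([set: V])%g)%N.
Proof.
move=> pV; have abV : abelian [set: V] by exact: FinRing.zmod_abelian.
rewrite (grank_abelian abV) (rank_pgroup pV) (p_rank_abelian _ abV).
rewrite -(card_pgroup (pgroupS (Ohm_sub 1 _) pV)) /= (OhmE 1 pV) expn1.
apply/subset_leq_card/(subset_trans _ (subset_gen _))/subsetP => x.
by rewrite !inE /= FinRing.zmodXgE.
Qed.

Section CharacterSampling.
Variables (C : numFieldType) (V : finZmodType) (p a : nat).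
Hypotheses (p_prime : prime p) (cardV : #|V| = (p ^ a)%N).
Variables (chi : V -> V -> C).
Hypotheses (chi0 : forall m, chi m 0 = 1)
  (chiD : forall m, {morph chi m : x y / x + y >-> x * y})
  (chi_orth : forall z, \sum_m chi m z = #|V|%:R * (z == 0)%:R).
Variable K : {set V}.
Hypotheses (K0 : 0 \in K) (KB : forall x y, x \in K -> y \in K -> x - y \in K).
Variable P : V -> C.
Hypotheses (P_ge0 : forall m, 0 <= P m)
  (PE : forall m, P m = #|V|%:R^-1 * \sum_(k in K) chi m k).

Let KN x : x \in K -> - x \in K.
Proof. by move=> Kx; rewrite -sub0r KB. Qed.

Let KD x y : x \in K -> y \in K -> x + y \in K.
Proof. by move=> Kx Ky; rewrite -[y]opprK KB ?KN. Qed.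

Let KMn x n : x \in K -> x *+ n \in K.
Proof. by move=> Kx; elim: n => [|n IHn]; rewrite ?mulr0n // mulrS KD. Qed.

Let chiMn m x n : chi m (x *+ n) = chi m x ^+ n.
Proof.
by elim: n => [|n IHn]; rewrite ?mulr0n ?chi0 // mulrS exprS chiD IHn.
Qed.

Let V_neq0 : #|V|%:R != 0 :> C.
Proof. by rewrite pnatr_eq0 cardV -lt0n expn_gt0 prime_gt0. Qed.

(** Translating the sum over [K] by [k] multiplies it by [chi m k], so a value other than 1 forces
    the sum to vanish. *)
Lemma prob_support m k : P m != 0 -> k \in K -> chi m k = 1.
Proof.
move=> Pm Kk; apply/eqP; apply: contraNT Pm => chik.
rewrite PE mulf_eq0; apply/orP; right.
have: (chi m k - 1) * (\sum_(x in K) chi m x) = 0.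
  rewrite mulrBl mul1r mulr_sumr [X in _ - X](reindex_inj (addrI k)) /=.
  apply/eqP; rewrite subr_eq0; apply/eqP/eq_big => [x|x _]; last by rewrite chiD.
  apply/idP/idP => [|Kkx]; first exact: KD.
  by rewrite -(addKr k x) KD ?KN.
by move/eqP; rewrite mulf_eq0 subr_eq0 (negPf chik).
Qed.

(** After exchanging the sums, orthogonality keeps the term [k = - z], which occurs exactly when [z]
    is in [K]. *)
Lemma expect_chi z : \sum_m P m * chi m z = (z \in K)%:R.
Proof.
under eq_bigr => m _ do rewrite PE -mulrA mulr_suml.
rewrite -mulr_sumr exchange_big /=.
under eq_bigr => k _.
  under eq_bigr do rewrite -chiD.
  rewrite chi_orth; over.
rewrite -mulr_sumr mulrA mulVf // mul1r.
have [Kz|nKz] := boolP (z \in K).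
  rewrite (bigD1 (- z)) ?KN //= addNr eqxx big1 ?addr0 // => k /andP[_ kz].
  by rewrite addr_eq0 (negPf kz).
rewrite big1 // => k Kk; case: eqP => // /eqP.
by rewrite addr_eq0 => /eqP kz; rewrite -[z]opprK -kz KN in nKz.
Qed.

Lemma prob_total : \sum_m P m = 1.
Proof. by have := expect_chi 0; rewrite K0; under eq_bigr do rewrite chi0 mulr1. Qed.

(** Bezout: [c] is coprime to [p], so [x] is an integer combination of [x *+ c] and [x *+ p]. *)
Let mulrn_coprime_notin x c : x \notin K -> x *+ p \in K -> (0 < c < p)%N ->
  x *+ c \notin K.
Proof.
move=> nKx Kpx /andP[c0 cp]; apply: contra nKx => Kcx.
have /eqP: coprime c p by rewrite coprime_sym prime_coprime // gtnNdvd.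
case: (egcdnP p c0) => u v uvE _ gcd1; rewrite gcd1 in uvE.
have -> : x = x *+ (u * c) - x *+ (v * p).
  by rewrite uvE mulrnDr addrC addKr.
rewrite mulnC mulrnA [(v * p)%N]mulnC mulrnA; apply: KB; exact: KMn.
Qed.

(* For [m] in the support of [P], [chi m x] is a [p]-th root of unity, so the
   event [chi m x = 1] is the average of [chi m (c x)] over [c < p]; its
   expectation counts the [c] with [c x] in [K]. *)
Lemma prob_chi_eq1 x : x \notin K -> x *+ p \in K ->
  \sum_(m | chi m x == 1) P m = p%:R^-1.
Proof.
move=> nKx Kpx; have p_neq0 : p%:R != 0 :> C by rewrite pnatr_eq0 -lt0n prime_gt0.
apply: (mulfI p_neq0); rewrite divff // big_mkcond /= mulr_sumr.
transitivity (\sum_m \sum_(c < p) P m * chi m (x *+ c)).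
  apply: eq_bigr => m _; rewrite -mulr_sumr.
  under [in RHS]eq_bigr do rewrite chiMn.
  have [->|Pm] := eqVneq (P m) 0; first by rewrite if_same mulr0 mul0r.
  case: eqP => [->|/eqP chix].
    under [in RHS]eq_bigr do rewrite expr1n.
    by rewrite sumr_const card_ord mulrC.
  rewrite mulr0; apply/esym/eqP; rewrite mulf_eq0 (negPf Pm) /=.
  (* A [p]-th root of unity other than 1 annihilates the geometric sum. *)
  have /eqP := subrX1 (chi m x) p.
  by rewrite -chiMn prob_support // subrr eq_sym mulf_eq0 subr_eq0 (negPf chix).
rewrite exchange_big /=; under eq_bigr do rewrite expect_chi.
rewrite (bigD1 (Ordinal (prime_gt0 p_prime))) //= mulr0n K0 big1 ?addr0 // => c c0.
rewrite (negPf (mulrn_coprime_notin _ _ nKx Kpx _)) // ltn_ord lt0n andbT.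
by apply: contraNneq c0 => c0; apply/eqP/val_inj.
Qed.

(** Abstract counterpart of [A_of]; [pairing0E] later identifies the two. *)
Definition kernel_of h (ms : {ffun 'I_h -> V}) : {set V} :=
  [set x | [forall k, chi (ms k) x == 1]].

(** Multiply a kernel element outside [K] by the last power of [p] that keeps it outside. *)
Let p_torsion_in_kernel h (ms : {ffun 'I_h -> V}) :
  K \subset kernel_of _ ms -> kernel_of _ ms != K ->
  exists2 x, x \in kernel_of _ ms & (x \notin K) && (x *+ p \in K).
Proof.
move=> KA AK; have [x Ax nKx]: exists2 x, x \in kernel_of _ ms & x \notin K.
  by apply/subsetPn; apply: contra AK => AK; rewrite eqEsubset AK.
have ex : exists n, x *+ (p ^ n) \in K.
  (* The order of [V] annihilates [x], and 0 is in [K]. *)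
  exists a; rewrite -cardV.
  have := expg_cardG (in_setT x); rewrite cardsT FinRing.zmodXgE => ->.
  exact: K0.
case: (ex_minnP ex) => [[|n]] Kn min_n; first by rewrite expn0 (negPf nKx) in Kn.
exists (x *+ (p ^ n)).
  rewrite !inE in Ax *; apply/forallP => k.
  by rewrite chiMn (eqP (forallP Ax k)) expr1n.
rewrite -mulrnA mulnC -expnS Kn andbT.
by apply/negP => /min_n; rewrite ltnn.
Qed.

(** Markov's inequality: on failure the kernel contains at least [#|K|] points of [S :\: K], and
    each such point lies in it with probability [p ^- h]. *)
Lemma fail_prob h :
  \sum_(ms : {ffun 'I_h -> V} | kernel_of _ ms != K) \prod_(k < h) P (ms k)
    <= #|[set x | x *+ p \in K]|%:R / (#|K|%:R * p%:R ^+ h).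
Proof.
have K_gt0 : 0 < #|K|%:R :> C by rewrite ltr0n; apply/card_gt0P; exists 0.
set S := [set x | _]; rewrite invfM mulrCA mulrC ler_pdivlMr // mulr_suml.
apply: (@le_trans _ _ (\sum_(ms : {ffun 'I_h -> V}) \sum_(x in S :\: K)
   \prod_(k < h) (P (ms k) * (chi (ms k) x == 1)%:R))).
  rewrite big_mkcond /=; apply: ler_sum => ms _; case: ifP => [AK|_]; last first.
    by apply: sumr_ge0 => x _; apply: prodr_ge0 => k _; rewrite mulr_ge0 ?ler0n.
  under [leRHS]eq_bigr do rewrite big_split /=.
  rewrite -mulr_sumr.
  (* Unless the outcome has weight zero, every sample is in the support of [P], so its character is
     trivial on [K]. *)
  have [->|P_neq0] := eqVneq (\prod_(k < h) P (ms k)) 0; first by rewrite !mul0r.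
  apply: ler_wpM2l; first exact: prodr_ge0.
  have chiK k x : x \in K -> chi (ms k) x = 1.
    by apply: prob_support; move/prodf_neq0: P_neq0; apply.
  have KA : K \subset kernel_of _ ms.
    by apply/subsetP => x Kx; rewrite inE; apply/forallP => k; rewrite chiK.
  have [x Ax /andP[nKx Kpx]] := p_torsion_in_kernel _ _ KA AK.
  (* The coset [x + K] supplies the [#|K|] points: it lies in the kernel and in [S :\: K]. *)
  rewrite -(card_imset _ (addrI x)) -sum1_card natr_sum.
  apply: (@le_trans _ _ (\sum_(y in [set x + k | k in K])
    \prod_(k < h) (chi (ms k) y == 1)%:R)).
    apply: ler_sum => _ /imsetP[k Kk ->]; rewrite big1 // => j _.
    move: Ax; rewrite inE => /forallP/(_ j)/eqP chix.
    by rewrite chiD chix chiK // mulr1 eqxx.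
  rewrite [leLHS]big_mkcond [leRHS]big_mkcond /=; apply: ler_sum => y _.
  case: imsetP => [[k Kk ->]|_]; last first.
    by case: ifP => // _; apply: prodr_ge0 => *; rewrite ler0n.
  have Kxkp : (x + k) *+ p \in K by rewrite mulrnDl KD // KMn.
  rewrite !inE Kxkp andbT ifT //.
  by apply: contra nKx => Kxk; rewrite -(addrK k x) KB.
rewrite exchange_big /=.
rewrite (eq_bigr (fun=> p%:R ^- h)) => [|x].
  rewrite sumr_const -[leLHS]mulr_natl ler_wpM2r ?invr_ge0 ?exprn_ge0 ?ler0n //.
  by rewrite ler_nat subset_leq_card ?subsetDl.
rewrite !inE => /andP[nKx Kpx].
(* Independence: the sum over all tuples factors into [h] equal sums. *)
rewrite -(bigA_distr_bigA (fun _ m => P m * (chi m x == 1)%:R)) /=.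
rewrite prodr_const card_ord -exprVn; congr (_ ^+ h).
rewrite -(prob_chi_eq1 _ nKx Kpx) [RHS]big_mkcond /=.
by apply: eq_bigr => m _; case: eqP => _; rewrite ?mulr1 ?mulr0.
Qed.

Lemma success_prob h :
  1 - #|[set x | x *+ p \in K]|%:R / (#|K|%:R * p%:R ^+ h) <=
  \sum_(ms : {ffun 'I_h -> V} | kernel_of _ ms == K) \prod_(k < h) P (ms k).
Proof.
have total : \sum_(ms : {ffun 'I_h -> V}) \prod_(k < h) P (ms k) = 1.
  by rewrite -(bigA_distr_bigA (fun _ m => P m)) prodr_const prob_total expr1n.
rewrite lerBlDr -[leLHS]total (bigID (fun ms => kernel_of _ ms == K)) /= lerD2l.
exact: fail_prob.
Qed.

End CharacterSampling.

(** * Characters of a product of cyclic groups *)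

Section RootsOfUnity.
Variable R : realType.
Implicit Types (t u : R) (n N : nat).
Local Open Scope complex_scope.

Lemma expi2piD t u : expi2pi (t + u) = expi2pi t * expi2pi u.
Proof.
rewrite /expi2pi mulrDr cosD sinD; apply/eqP; rewrite eq_complex /=.
by rewrite eqxx addrC eqxx.
Qed.

Lemma expi2pi0 : expi2pi (0 : R) = 1.
Proof. by rewrite /expi2pi mulr0 cos0 sin0. Qed.

Lemma expi2pi_conj t : Num.conj (expi2pi t) = (expi2pi t)^-1.
Proof.
have h : expi2pi t * (expi2pi t)^* = 1.
  apply/eqP; rewrite /expi2pi eq_complex /= mulrN opprK -!expr2 cos2Dsin2 eqxx /=.
  by rewrite mulrN [sin _ * _]mulrC addNr.
have nz : expi2pi t != 0.
  by apply: contra_eq_neq h => ->; rewrite mul0r eq_sym oner_eq0.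
by apply: (mulfI nz); rewrite h divff.
Qed.

Lemma expi2pi_nat n : expi2pi (n%:R : R) = 1.
Proof.
elim: n => [|n IHn]; first exact: expi2pi0.
by rewrite -natr1 expi2piD IHn mul1r /expi2pi mulr1 mulr_natl cos2pi sin2pi.
Qed.

(** The real part is [1 - 2 sin^2 (pi t)], and the sine is positive on []0, pi[]. *)
Lemma expi2pi_neq1 t : 0 < t < 1 -> expi2pi t != 1.
Proof.
move=> /andP[t0 t1]; rewrite /expi2pi eq_complex /= negb_and; apply/orP; left.
rewrite -mulrA mulr_natl mulr2n cosD -!expr2 cos2sin2.
rewrite -subr_eq0 -[1 - _ - _]addrA [1 + _]addrC addrK -opprD oppr_eq0 -mulr2n.
rewrite mulrn_eq0 sqrf_eq0 /=; apply/lt0r_neq0/sin_gt0_pi.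
by rewrite mulr_gt0 ?pi_gt0 // gtr_pMr // pi_gt0.
Qed.

Lemma expi2pi_int (z : int) : expi2pi (z%:~R : R) = 1.
Proof.
case: (intP z) => [|n|n]; first exact: expi2pi0.
  exact: (expi2pi_nat n.+1).
have := expi2pi0; rewrite -[X in expi2pi X = _](subrr n.+1%:R) expi2piD.
by rewrite expi2pi_nat mul1r mulrNz.
Qed.

(** Subtracting the floor does not change [expi2pi], and a nonzero fractional part is excluded by
    [expi2pi_neq1]. *)
Lemma expi2pi_eq1 t : (expi2pi t == 1) = (t \is a Num.int).
Proof.
apply/eqP/idP => [tE|/intrP[z ->]]; last exact: expi2pi_int.
have [fl_le lt_fl] := andP (floor_itv t).
apply: contraT; rewrite intrEfloor => ne.
suff /expi2pi_neq1 : 0 < t - (Num.floor t)%:~R < 1.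
  by rewrite expi2piD tE -mulrNz expi2pi_int mulr1 eqxx.
rewrite subr_gt0 lt_neqAle ne fl_le ltrBlDl.
by move: lt_fl; rewrite rmorphD.
Qed.

Lemma expi2pi_modn N n : (0 < N)%N ->
  expi2pi ((n %% N)%:R / N%:R : R) = expi2pi (n%:R / N%:R).
Proof.
move=> N_gt0; rewrite [in RHS](divn_eq n N) natrD natrM mulrDl mulfK; last first.
  by rewrite pnatr_eq0 -lt0n.
by rewrite expi2piD expi2pi_nat mul1r.
Qed.

End RootsOfUnity.

(* An alias, so that its additive structure does not clash with the product-group
   instance that MathComp attaches to dependent finite functions. *)
Definition prodZ {n : nat} (N : 'I_n -> nat) : Type := {dffun forall j, 'Z_(N j)}.

Section ProdZ.
Variables (n : nat) (N : 'I_n -> nat).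
Implicit Types x y z : prodZ N.

HB.instance Definition _ :=
  Finite.copy (prodZ N) {dffun forall j : 'I_n, 'Z_(N j)}.

Definition prodZ_zero : prodZ N := [ffun=> 0].
Definition prodZ_opp x : prodZ N := [ffun j => - x j].
Definition prodZ_add x y : prodZ N := [ffun j => x j + y j].

Let prodZ_addA : associative prodZ_add.
Proof. by move=> x y z; apply/ffunP => j; rewrite !ffunE addrA. Qed.
Let prodZ_addC : commutative prodZ_add.
Proof. by move=> x y; apply/ffunP => j; rewrite !ffunE addrC. Qed.
Let prodZ_add0 : left_id prodZ_zero prodZ_add.
Proof. by move=> x; apply/ffunP => j; rewrite !ffunE add0r. Qed.
Let prodZ_addN : left_inverse prodZ_zero prodZ_opp prodZ_add.
Proof. by move=> x; apply/ffunP => j; rewrite !ffunE addNr. Qed.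

HB.instance Definition _ :=
  GRing.isZmodule.Build (prodZ N) prodZ_addA prodZ_addC prodZ_add0 prodZ_addN.

Lemma prodZ_addE x y j : (x + y) j = x j + y j. Proof. by rewrite ffunE. Qed.
Lemma prodZ_0E j : (0 : prodZ N) j = 0. Proof. by rewrite ffunE. Qed.
End ProdZ.

(** * Character orthogonality on the product group *)

Section ProdZCharacter.
Variables (R : realType) (n : nat) (N : 'I_n -> nat).
Hypothesis N_gt1 : forall j, (1 < N j)%N.
Implicit Types x y z : prodZ N.
Local Open Scope complex_scope.

Definition chi x y : R[i] :=
  \prod_j expi2pi ((nat_of_ord (x j) * nat_of_ord (y j))%:R / (N j)%:R).

Lemma chi_sym x y : chi x y = chi y x.
Proof. by apply: eq_bigr => j _; rewrite mulnC. Qed.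

Lemma chi0 x : chi x 0 = 1.
Proof.
by apply: big1 => j _; rewrite prodZ_0E muln0 mul0r expi2pi0.
Qed.

(** Addition in ['Z_(N j)] reduces modulo [N j], which [expi2pi] does not see; [N_gt1] makes the
    modulus exactly [N j]. *)
Lemma chiD x : {morph chi x : y z / y + z >-> y * z}.
Proof.
move=> y z; rewrite -big_split /=; apply: eq_bigr => j _.
have yzE : nat_of_ord ((y + z) j) = ((y j + z j) %% N j)%N.
  by rewrite prodZ_addE; exact: (congr1 (modn _) (Zp_cast (N_gt1 j))).
rewrite -expi2piD -mulrDl -natrD -mulnDr yzE.
by rewrite -[LHS]expi2pi_modn ?modnMmr ?expi2pi_modn // ltnW.
Qed.

(** Both sides are inverse to [chi x y]. *)
Lemma chi_conj x y : Num.conj (chi x y) = chi x (- y).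
Proof.
have h : chi x y * chi x (- y) = 1 by rewrite -chiD subrr chi0.
have nz : chi x y != 0.
  by apply: contra_eq_neq h => ->; rewrite mul0r eq_sym oner_eq0.
apply: (mulfI nz); rewrite h -[RHS](divff nz) -prodfV rmorph_prod.
by congr (_ * _); apply: eq_bigr => j _; exact: expi2pi_conj.
Qed.

Lemma chi_orth z : \sum_x chi x z = #|{: prodZ N}|%:R * (z == 0)%:R.
Proof.
have [->|nz] := eqVneq z 0.
  by rewrite mulr1; under eq_bigr do rewrite chi0; rewrite sumr_const.
have [j zj] : exists j, z j != 0.
  apply/existsP; apply: contraNT nz; rewrite negb_exists => /forallP z0.
  by apply/eqP/ffunP => j; rewrite prodZ_0E; apply/eqP; have := z0 j; rewrite negbK.
(* With this unit vector, [chi e z] is [expi2pi] of a fraction strictly between 0 and 1. Translation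
   by [e] preserves the sum but multiplies it by [chi e z]. *)
pose e : prodZ N := [ffun k => if k == j then 1 else 0].
have chi_e : chi e z != 1.
  rewrite /chi (bigD1 j) //= big1 ?mulr1 => [|k kj]; last first.
    by rewrite ffunE (negPf kj) mul0n mul0r expi2pi0.
  rewrite ffunE eqxx mul1n; apply: expi2pi_neq1.
  have N_gt0 : 0 < (N j)%:R :> R by rewrite ltr0n ltnW.
  apply/andP; split.
    apply: divr_gt0 => //; rewrite ltr0n.
    by rewrite lt0n; apply: contra zj => /eqP z0; apply/eqP/val_inj.
  rewrite ltr_pdivrMr // mul1r ltr_nat.
  by apply: leq_trans (ltn_ord (z j)) _; rewrite Zp_cast.
have nz1 : chi e z - 1 != 0 by rewrite subr_eq0.
apply: (mulfI nz1); rewrite !mulr0 mulrBl mul1r mulr_sumr.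
rewrite [X in _ - X](reindex_inj (addrI e)) /=.
by rewrite -sumrB big1 // => x _; rewrite ![chi _ z]chi_sym chiD subrr.
Qed.

Lemma card_prodZ : #|{: prodZ N}| = (\prod_j N j)%N.
Proof.
rewrite card_dep_ffun foldrE big_map big_enum /=.
by apply: eq_bigr => j _; rewrite card_ord Zp_cast.
Qed.

End ProdZCharacter.

(** Since [p >= 2], it suffices that [2 ^ (h - d) >= t], which is the ceiling condition after taking
    logarithms. *)
Lemma ratio_le_log (R : realType) (p d h : nat) (t : R) :
  (1 < p)%N -> 1 <= t -> d%:Z + Num.ceil (ln t / ln 2) <= h%:Z ->
  p%:R ^+ d / p%:R ^+ h <= t^-1.
Proof.
move=> p_gt1 t_ge1.
have t_gt0 : 0 < t by apply: lt_le_trans t_ge1.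
have ln2_gt0 : 0 < ln (2 : R) by rewrite ln_gt0 // ltr1n.
rewrite addrC -lerBrDr ceil_le_int ler_pdivrMr // => ht.
(* [ln t >= 0] makes the natural subtraction [h - d] exact. *)
have dh : (d <= h)%N.
  rewrite -lez_nat -subr_ge0 -(ler0z R) -(pmulr_lge0 _ ln2_gt0).
  by apply: le_trans ht; exact: ln_ge0.
have p_gt0 : 0 < p%:R :> R by rewrite ltr0n ltnW.
rewrite -invf_div lef_pV2 ?posrE ?divr_gt0 ?exprn_gt0 // -expfB_cond ?gt_eqF //.
apply: (@le_trans _ _ (2 ^+ (h - d))); last by rewrite lerXn2r ?nnegrE ?ler0n ?ler_nat.
rewrite -ler_ln ?posrE ?exprn_gt0 // lnXn //.
by move: ht; rewrite subzn // mulr_natl.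
Qed.

(** * The measurement distribution *)

Section Sampling.
Variables (R : realType) (m : nat) (p r : 'I_m -> nat).
Variables (al : forall i : 'I_m, 'I_(r i) -> nat) (i : 'I_m).
Hypotheses (p_prime : prime (p i)) (al_ge1 : forall j, (0 < al i j)%N).
Local Open Scope complex_scope.

Let N (j : 'I_(r i)) := (p i ^ al i j)%N.
Let V := prodZ N.

Let N_gt1 j : (1 < N j)%N.
Proof. by rewrite -(exp1n (al i j)) ltn_exp2r ?prime_gt1. Qed.

Lemma pairing0E (x y : V) :
  pairing0 R (x : Gi p al i) (y : Gi p al i) = (chi R _ N x y == 1).
Proof.
rewrite /pairing0 -expi2pi_eq1 /chi; congr (_ == 1).
by apply: (big_morph (@expi2pi R) (@expi2piD R) (expi2pi0 R)).
Qed.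

Let s : R := \prod_j (Num.sqrt (N j)%:R)^-1.

Lemma qftGiE (y x : V) : qftGi R (y : Gi p al i) (x : Gi p al i) = s%:C * chi R _ N x y.
Proof. by rewrite /qftGi big_split rmorph_prod. Qed.

Lemma qft_scale_sqr : s ^+ 2 = #|{: V}|%:R^-1.
Proof.
rewrite /s -prodrXl card_prodZ // natr_prod -prodfV; apply: eq_bigr => j _.
by rewrite exprVn sqr_sqrtr.
Qed.

Lemma subG_eq0 (b c : Gall p al) : (subG b c == zeroG p al) = (b == c).
Proof.
apply/eqP/eqP => [bc|->]; last first.
  by apply/ffunP => k; apply/ffunP => j; rewrite !ffunE subrr.
apply/ffunP => k; apply/ffunP => j.
have := congr1 (fun f : Gall p al => f k j) bc; rewrite !ffunE => /eqP.
by rewrite subr_eq0 => /eqP.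
Qed.

Lemma conj_real_complex (a : R) : Num.conj (a%:C : R[i]) = a%:C.
Proof. exact: conjc_real. Qed.

(** The first transform yields the uniform superposition, the oracle keeps the amplitude of [y] at
    [b = fi y], and the inverse transform contributes the conjugate character. *)
Lemma final_stateE (fi : Gi p al i -> Gall p al) (x : V) b :
  final_state R fi x b = (s ^+ 2)%:C * \sum_(y : V | fi y == b) (chi R _ N x y)^*.
Proof.
rewrite /final_state /apply_qft_dag big_distrr [RHS]big_mkcond /=.
apply: eq_bigr => y _; rewrite /apply_U /apply_qft qftGiE.
rewrite (bigD1 (zeroGi p al i)) //= big1 ?addr0 => [|z /negPf z0]; last first.
  by rewrite /init_state z0 mulr0.
rewrite /init_state eqxx subG_eq0 eq_sym qftGiE /=; case: eqP => _; last first.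
  by rewrite !mulr0.
have -> : chi R _ N (zeroGi p al i) y = 1 by rewrite chi_sym; exact: chi0.
by rewrite !mulr1 rmorphM /= conj_real_complex chi_sym mulrAC -rmorphM.
Qed.

Lemma sqnormE (z : R[i]) : (sqnorm z)%:C = z * Num.conj z.
Proof.
case: z => a b; apply/eqP; rewrite eq_complex /sqnorm /=.
by rewrite !mulrN opprK !expr2 eqxx mulrC addNr /=.
Qed.

(** Expanding the squared amplitudes gives a sum over collisions [fi y = fi z], whose terms depend
    only on [z - y], an element of [K]. *)
Lemma meas_probE (fi : Gi p al i -> Gall p al) (K : {set V}) (x : V) :
  (forall y z : V, fi y = fi z <-> y - z \in K) ->
  (meas_prob R fi x)%:C = #|{: V}|%:R^-1 * \sum_(k in K) chi R _ N x k.
Proof.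
move=> fiE.
have V_neq0 : #|{: V}|%:R != 0 :> R.
  by rewrite pnatr_eq0 card_prodZ // -lt0n prodn_gt0 // => j; rewrite ltnW.
pose S := \sum_(y : V) \sum_(z : V | fi z == fi y) chi R _ N x (z - y).
have -> : (meas_prob R fi x)%:C = (s ^+ 2)%:C ^+ 2 * S.
  rewrite /meas_prob rmorph_sum /= mulr_sumr.
  under eq_bigr => b _.
    rewrite sqnormE final_stateE [Num.conj _]rmorphM /= conj_real_complex mulrACA -expr2.
    rewrite rmorph_sum mulr_suml /=; over.
  rewrite [RHS](partition_big fi predT) //=; apply: eq_bigr => b _.
  rewrite mulr_sumr; apply: eq_bigr => y /eqP yb; congr (_ * _).
  rewrite mulr_sumr yb; apply: eq_bigr => z _.
  by rewrite conjCK chiD // chi_conj // mulrC.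
(* Putting [k = z - y], every [y] contributes the same sum over [K]. *)
have -> : S = #|{: V}|%:R * \sum_(k in K) chi R _ N x k.
  rewrite /S (eq_bigr (fun=> \sum_(k in K) chi R _ N x k)) => [|y _].
    by rewrite sumr_const mulr_natl.
  rewrite [RHS](reindex_inj (addIr (- y))) /=; apply: eq_bigl => z.
  by apply/eqP/idP => /fiE.
(* The constants combine as [s ^ 4 * |V| = |V|^-1]. *)
rewrite qft_scale_sqr fmorphV rmorph_nat mulrA; congr (_ * _).
by rewrite expr2 -mulrA mulVf ?mulr1 // -(rmorph_nat (real_complex R)) fmorph_eq0.
Qed.

End Sampling.

(** * Subgroup sizes and the success probability *)

Lemma group_subr (V : finZmodType) (H : {group V}) (x y : V) :
  x \in H -> y \in H -> x - y \in H.
Proof.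
by move=> Hx Hy; rewrite -FinRing.zmodVgE -FinRing.zmodMgE groupM ?groupV.
Qed.

Lemma group_set_subr (V : finZmodType) (H : {set V}) :
  0 \in H -> (forall x y, x \in H -> y \in H -> x - y \in H) -> group_set H.
Proof.
move=> H0 HB; apply/group_setP; split=> [|x y Hx Hy]; first exact: H0.
by rewrite FinRing.zmodMgE -[y]opprK HB // -sub0r HB.
Qed.

(** * Rank, length and subgroup orders in a node group *)

Section NodeGroup.
Variables (m : nat) (p r : 'I_m -> nat).
Variables (al : forall i : 'I_m, 'I_(r i) -> nat) (i : 'I_m).
Hypotheses (p_prime : prime (p i)) (al_ge1 : forall j, (0 < al i j)%N).

Let N (j : 'I_(r i)) := (p i ^ al i j)%N.
Let V : finZmodType := prodZ N.

Lemma card_Gi : #|{: V}| = (p i ^ \sum_j al i j)%N.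
Proof.
rewrite card_prodZ ?expn_sum // => j.
by rewrite -(exp1n (al i j)) ltn_exp2r ?prime_gt1.
Qed.

Lemma pgroup_Gi : ((p i).-group [set: V])%g.
Proof. by rewrite /pgroup cardsT card_Gi pnatX pnat_id. Qed.

Lemma subgroupGi_subr (H : {set Gi p al i}) :
  subgroupGi H ->
  ((0 : V) \in H) * (forall x y : V, x \in H -> y \in H -> x - y \in H).
Proof.
case/andP => H0 /forall_inP HB; split=> // x y Hx Hy.
have -> : x - y = subGi x y by apply/ffunP => j; rewrite !ffunE.
by move/forall_inP: (HB x Hx); apply.
Qed.

Lemma subgroupGi_group_set (H : {set V}) :
  subgroupGi (H : {set Gi p al i}) -> group_set (H : {set V}).
Proof.
by case/subgroupGi_subr => H0 HB; apply: group_set_subr.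
Qed.

Lemma group_subgroupGi (H : {group V}) :
  subgroupGi (H : {set Gi p al i}).
Proof.
apply/andP; split; first exact: (group1 H).
apply/forall_inP => x Hx; apply/forall_inP => y Hy.
have -> : subGi x y = (x : V) - (y : V) by apply/ffunP => j; rewrite !ffunE.
exact: (@group_subr V H x y Hx Hy).
Qed.

(** A set spanning in the sense of [spanGi] also generates the group, because its generated subgroup
    is one of those intersected in [spanGi]. *)
Lemma grank_le_rankGi : ('m([set: V])%g <= rankGi [set: Gi p al i])%N.
Proof.
rewrite /rankGi; case: arg_minnP => [|S /eqP spanS _].
  (* The default value of the arg min is admissible: the whole group spans itself. *)
  rewrite eqEsubset subsetT; apply/bigcapsP => H /andP[_]; exact.
have -> : [set: V] = <<(S : {set V})>>%g; last exact: grank_min.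
apply/eqP; rewrite eq_sym eqEsubset subsetT /=.
have <- : spanGi S = [set: V] by [].
apply: bigcap_inf; apply/andP; split; [exact: group_subgroupGi|exact: (@subset_gen V)].
Qed.

Lemma lenGi_pgroup (H : {set Gi p al i}) a :
  #|H| = (p i ^ a)%N -> lenGi H = a.
Proof.
rewrite /lenGi => ->; case: a => [|a]; first by rewrite expn0 big_nil.
by rewrite primesX // primes_prime // big_seq1 pfactorK.
Qed.

Lemma card_subgroupGi (H : {set Gi p al i}) :
  subgroupGi H -> #|H| = (p i ^ lenGi H)%N.
Proof.
move=> sH; pose G := Group (subgroupGi_group_set H sH).
have pG : ((p i).-group G)%g by exact: pgroupS (subsetT _) pgroup_Gi.
have cardH : #|H| = (p i ^ logn (p i) #|H|)%N := card_pgroup pG.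
by rewrite {1}cardH (lenGi_pgroup _ _ cardH).
Qed.

Lemma len_le_Gi (H : {set Gi p al i}) :
  subgroupGi H -> (lenGi H <= lenGi [set: Gi p al i])%N.
Proof.
move=> sH; rewrite -(leq_exp2l _ _ (prime_gt1 p_prime)) -card_subgroupGi //.
by rewrite -card_subgroupGi ?subset_leq_card ?subsetT // (group_subgroupGi [set: V]%G).
Qed.

Lemma card_mulrn_preim_le_rank (H : {set V}) :
  (#|[set x : V | (x *+ p i)%R \in H]|
    <= #|H| * p i ^ rankGi [set: Gi p al i])%N.
Proof.
apply: leq_trans (card_mulrn_preim _ _) _; rewrite leq_mul2l; apply/orP; right.
apply: leq_trans (card_torsion_le _ pgroup_Gi) _.
by rewrite leq_exp2l ?prime_gt1 // grank_le_rankGi.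
Qed.

(** The trivial bound by [|G_i|], factored as [|H|] times a power of [p i]; [len_le_Gi] makes the
    subtraction exact. *)
Lemma card_mulrn_preim_le_len (H : {set V}) :
  subgroupGi (H : {set Gi p al i}) ->
  (#|[set x : V | (x *+ p i)%R \in H]| <=
     #|H| * p i ^ (lenGi [set: Gi p al i] - lenGi (H : {set Gi p al i})))%N.
Proof.
move=> sH; rewrite [in X in (_ <= X * _)%N]card_subgroupGi // -expnD subnKC ?len_le_Gi //.
rewrite -card_subgroupGi ?(group_subgroupGi [set: V]%G) //.
by rewrite subset_leq_card ?subsetT.
Qed.

End NodeGroup.

(** * Success probability of the measured samples *)

Section Success.
Variables (R : realType) (m : nat) (p r : 'I_m -> nat).
Variables (al : forall i : 'I_m, 'I_(r i) -> nat) (i : 'I_m).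
Hypotheses (p_prime : prime (p i)) (al_ge1 : forall j, (0 < al i j)%N).
Variables (fi : Gi p al i -> Gall p al) (H : {set Gi p al i}).
Hypotheses (sH : subgroupGi H) (fiE : forall x y, fi x = fi y <-> subGi x y \in H).
Local Open Scope complex_scope.

(** Here [d] stands for the rank or for the difference of lengths, so both thresholds share one
    argument. *)
Lemma prob_A_eq_ge (d h : nat) (t : R) :
  (#|[set x : prodZ (fun j => p i ^ al i j)%N | (x *+ p i)%R \in H]|
    <= #|H| * p i ^ d)%N ->
  1 <= t -> d%:Z + Num.ceil (ln t / ln 2) <= h%:Z ->
  1 - t^-1 <= prob_A_eq R fi h H.
Proof.
set V := prodZ _ => card_le t_ge1 dh.
have N_gt1 j : (1 < p i ^ al i j)%N.
  by rewrite -(exp1n (al i j)) ltn_exp2r ?prime_gt1.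
have [H0 HB] := subgroupGi_subr _ _ _ _ _ _ sH.
have fiE' (x y : V) : fi x = fi y <-> x - y \in H.
  by rewrite fiE; have -> : subGi x y = x - y by apply/ffunP => j; rewrite !ffunE.
have P_ge0 (x : V) : 0 <= (meas_prob R fi x)%:C :> R[i].
  by rewrite ler0c; apply: sumr_ge0 => b _; rewrite addr_ge0 ?sqr_ge0.
have := @success_prob R[i] V _ _ p_prime (card_Gi _ _ _ _ _ p_prime al_ge1)
  (chi R _ _) (chi0 R _ _) (chiD R _ _ N_gt1) (chi_orth R _ _ N_gt1) H H0 HB
  _ P_ge0 (fun x => meas_probE _ _ _ _ _ _ p_prime al_ge1 fi H x fiE') h.
set S := [set x | _].
have probE : (prob_A_eq R fi h H)%:C =
    \sum_(ms : {ffun 'I_h -> V} | kernel_of _ _ (chi R _ _) h ms == H)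
       \prod_(k < h) (meas_prob R fi (ms k))%:C.
  rewrite rmorph_sum; apply: eq_big => [ms|ms _]; last by rewrite rmorph_prod.
  congr (_ == _); apply/setP => x; rewrite !inE.
  by apply: eq_forallb => k; exact: pairing0E.
(* All quantities are real, so the inequality in [R[i]] descends to [R]. *)
rewrite -probE -!(rmorph_nat (real_complex R)) -rmorphXn -rmorphM -fmorphV -rmorphM.
rewrite -rmorphB lecR; apply: le_trans; rewrite lerD2l lerN2.
have H_gt0 : 0 < #|H|%:R :> R.
  by rewrite ltr0n; apply/card_gt0P; exists (zeroGi p al i); exact: H0.
have p_gt0 : 0 < (p i)%:R :> R by rewrite ltr0n prime_gt0.
apply: le_trans (ratio_le_log R _ _ _ _ (prime_gt1 p_prime) t_ge1 dh).
rewrite invfM mulrA ler_pM2r ?invr_gt0 ?exprn_gt0 // ler_pdivrMr //.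
by rewrite -natrX -natrM mulnC ler_nat.
Qed.

End Success.

(** * The two thresholds on the number of repetitions *)

Theorem theorem8 (R : realType) (m : nat) (p r : 'I_m -> nat)
  (al : forall i : 'I_m, 'I_(r i) -> nat)
  (p_prime : forall i, prime (p i)) (p_inj : injective p)
  (al_ge1 : forall i j, (0 < al i j)%N)
  (f : Gall p al -> Gall p al) (K : {set Gall p al})
  (Ks : forall i : 'I_m, {set Gi p al i})
  (K_subgroup : subgroupG K) (Ks_subgroup : forall i, subgroupGi (Ks i))
  (K_def : K = [set x : Gall p al | [forall k, x k \in Ks k]])
  (f_hides : forall x y, f x = f y <-> subG x y \in K)
  (i : 'I_m) (eps : R) (eps_gt0 : 0 < eps) (eps_lt1 : eps < 1) (h : nat) :
  ((h%:Z >= (rankGi [set: Gi p al i])%:Z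
              + Num.ceil (ln (2 * m%:R / eps) / ln 2))
   \/ (h%:Z >= (lenGi [set: Gi p al i])%:Z - (lenGi (Ks i))%:Z
              + Num.ceil (ln (m%:R / eps) / ln 2))) ->
  prob_A_eq R (fun g : Gi p al i => f (embedG g)) h (Ks i) >= 1 - eps / m%:R.
Proof.
have fiE (x y : Gi p al i) : f (embedG x) = f (embedG y) <-> subGi x y \in Ks i.
  rewrite f_hides K_def inE; split=> [/forallP/(_ i)|Kxy].
    by rewrite !ffunE !dfwith_in.
  apply/forallP => k; rewrite !ffunE.
  have [<-|ki] := eqVneq i k; first by rewrite !dfwith_in.
  (* Away from node [i] both embeddings are zero, so their difference lies in [Ks k]. *)
  rewrite !dfwith_out //; have /andP[K0 _] := Ks_subgroup k.
  suff -> : subGi (zeroGi p al k) (zeroGi p al k) = zeroGi p al k by [].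
  by apply/ffunP => j; rewrite !ffunE subrr.
have m_gt0 : 0 < m%:R :> R by rewrite ltr0n (leq_ltn_trans _ (ltn_ord i)).
have t_ge1 : 1 <= m%:R / eps.
  rewrite ler_pdivlMr // mul1r (le_trans (ltW eps_lt1)) // ler1n.
  by rewrite (leq_ltn_trans _ (ltn_ord i)).
have t_gt0 : 0 < m%:R / eps by rewrite divr_gt0.
have bound := prob_A_eq_ge R _ _ _ _ i (p_prime i) (al_ge1 i) _ _ (Ks_subgroup i) fiE.
case=> [rank_h|len_h]; rewrite -invf_div; last first.
  have card_le := card_mulrn_preim_le_len _ _ _ _ _ (p_prime i) (al_ge1 i) _ (Ks_subgroup i).
  apply: (bound _ _ _ card_le t_ge1).
  by rewrite -subzn // len_le_Gi.
have card_le := card_mulrn_preim_le_rank _ _ _ _ _ (p_prime i) (al_ge1 i) (Ks i).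
(* Taking [t = 2 m / eps] bounds the failure by [eps / (2 m)], which is at most [eps / m]. *)
have t_le : m%:R / eps <= 2 * m%:R / eps.
  by rewrite -mulrA ler_peMl ?ler1n // ltW.
apply: le_trans (bound _ _ _ card_le (le_trans t_ge1 t_le) rank_h).
by rewrite lerD2l lerN2 lef_pV2 ?posrE // (lt_le_trans t_gt0).
Qed.
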